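(* Let $B_1(0)\subset\mathbb{R}^2$ be the open unit disc and set $\sigma(t):=\frac{2t}{1+t}$ for $t\ge0$. For $(x,y)=(r\cos\theta,r\sin\theta)$ define $u(r,\theta):=u_h(r,\theta)+u_p(r)$, where $$u_h(r,\theta):=\sum_{n=2}^\infty\frac{r^n}{n^2\ln n}\cos(n\theta),\qquad u_p(r):=\frac14(1-r^2),$$ and on $\partial B_1(0)$ define $$g_h(\cos\theta,\sin\theta):=\sum_{n=2}^\infty\frac{\cos(n\theta)}{n^2\ln n}.$$ Then $g_h\in C^1(\partial B_1(0))$, and $u\in C^0(\overline{B_1(0)})\cap C^\infty(B_1(0))$ is a classical, and hence viscosity, solution of the Dirichlet problem $$\sigma(|Du|)\Delta u=f\ \text{ in }B_1(0),\qquad u=g_h\ \text{ on }\partial B_1(0),$$ where $f(x,y):=-\frac{2|Du(x,y)|}{1+|Du(x,y)|}$. Moreover $f\in C^0(B_1(0))\cap L^\infty(B_1(0))$, while $$\lim_{r\to1^-}\partial_ru(r,0)=+\infty.$$ Therefore $u\notin C^1(\overline{B_1(0)})$.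
   Context: Viscosity solution of $\sigma(|Du|)\Delta u=f$ in $B_1(0)$: $u$ is continuous and, whenever $\psi\in C^2(B_1(0))$ and $u-\psi$ has a local minimum (resp. local maximum) at $x_0\in B_1(0)$, one has $\sigma(|D\psi(x_0)|)\Delta\psi(x_0)\le f(x_0)$ (resp. $\ge f(x_0)$). *)

(* Defs.v *)
From HB Require Import structures.
From mathcomp Require Import all_boot all_order all_algebra.
From mathcomp Require Import all_classical all_reals all_analysis.

Set Implicit Arguments.
Unset Strict Implicit.
Unset Printing Implicit Defensive.

Import Order.TTheory GRing.Theory Num.Theory.
Import numFieldNormedType.Exports.

Local Open Scope classical_set_scope.
Local Open Scope ring_scope.

Section plane.
Context {R : realType}.
Implicit Types (D : set (R * R)) (f g u psi : R * R -> R) (p : R * R).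

Definition e1 : R * R := (1, 0).
Definition e2 : R * R := (0, 1).

(* The library norm on [R * R] is the sup norm; it induces the usual topology,
   but Euclidean lengths have to be written out. *)
Definition enorm p : R := Num.sqrt (p.1 ^+ 2 + p.2 ^+ 2).

Definition grad u p : R * R := ('D_e1 u p, 'D_e2 u p).

Definition laplacian u p : R := 'D_e1 ('D_e1 u) p + 'D_e2 ('D_e2 u) p.

Definition bdry D : set (R * R) := closure D `\` D°.

(* C^k(D), for D open: all partial derivatives of order at most k exist and are
   continuous on D. *)
Fixpoint Ck (k : nat) D f : Prop :=
  {within D, continuous f} /\
  if k is k'.+1 then
    [/\ forall p, D p -> derivable f p e1, forall p, D p -> derivable f p e2,
        Ck k' D ('D_e1 f) & Ck k' D ('D_e2 f)]
  else True.

Definition Cinfty D f : Prop := forall k, Ck k D f.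

(* C^1(closure D), for D open: f is continuous on the closure, C^1 inside, and
   its first partial derivatives extend continuously to the closure. *)
Definition C1_closure D f : Prop :=
  [/\ {within closure D, continuous f}, Ck 1 D f,
      exists2 g, {within closure D, continuous g} &
                 forall p, D p -> g p = 'D_e1 f p
    & exists2 g, {within closure D, continuous g} &
                 forall p, D p -> g p = 'D_e2 f p].

(* C^1 on the unit circle, seen as a manifold with charts t |-> (cos t, sin t) *)
Definition C1_circle g : Prop :=
  let h := fun t : R => g (cos t, sin t) in
  (forall t, derivable h t 1) /\ continuous (derive1 h).

(* L^oo(D) for the Lebesgue measure of the plane, through extension by zero *)
Definition Linfty D f : Prop :=
  (f \_ D : measurableTypeR R * measurableTypeR R -> R) \in
    Lfun (lebesgue_measure \x lebesgue_measure)%E +oo%E.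

Definition locally_min f p : Prop := \forall q \near p, f p <= f q.
Definition locally_max f p : Prop := \forall q \near p, f q <= f p.

(* Solutions of  sigma(|Du|) Lap u = f  in D,  u = g  on bdry D *)

Definition classical_solution (sigma : R -> R) D f g u : Prop :=
  [/\ Ck 2 D u, {within closure D, continuous u},
      forall p, D p -> sigma (enorm (grad u p)) * laplacian u p = f p
    & forall p, bdry D p -> u p = g p].

Definition viscosity_solution_in (sigma : R -> R) D f u : Prop :=
  [/\ {within D, continuous u},
      forall psi p, Ck 2 D psi -> D p -> locally_min (u \- psi) p ->
        sigma (enorm (grad psi p)) * laplacian psi p <= f p
    & forall psi p, Ck 2 D psi -> D p -> locally_max (u \- psi) p ->
        f p <= sigma (enorm (grad psi p)) * laplacian psi p].

Definition viscosity_solution (sigma : R -> R) D f g u : Prop :=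
  [/\ viscosity_solution_in sigma D f u, {within closure D, continuous u}
    & forall p, bdry D p -> u p = g p].

Definition unit_disc : set (R * R) := [set p | enorm p < 1].

Definition sigma (t : R) : R := 2 * t / (1 + t).

(* Partial sums over 2 <= n < N of the two cosine series *)

Definition u_h_partial (r theta : R) (N : nat) : R :=
  \sum_(2 <= n < N) r ^+ n / (n%:R ^+ 2 * ln n%:R) * cos (n%:R * theta).

Definition g_h_partial (theta : R) (N : nat) : R :=
  \sum_(2 <= n < N) cos (n%:R * theta) / (n%:R ^+ 2 * ln n%:R).

Definition u_h_polar (r theta : R) : R := limn (u_h_partial r theta).
Definition u_p_polar (r : R) : R := (1 - r ^+ 2) / 4.
Definition u_polar (r theta : R) : R := u_h_polar r theta + u_p_polar r.
Definition g_h_polar (theta : R) : R := limn (g_h_partial theta).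

(* Polar angle in ]-pi, pi]; its value at the origin is irrelevant, since
   [u_polar 0] is constant. *)
Definition angle p : R :=
  let t := acos (p.1 / enorm p) in if 0 <= p.2 then t else - t.

Definition u_sol p : R := u_polar (enorm p) (angle p).
Definition g_h p : R := g_h_polar (angle p).

Definition f_rhs p : R :=
  - (2 * enorm (grad u_sol p) / (1 + enorm (grad u_sol p))).

End plane.

Arguments unit_disc : clear implicits.
Arguments u_sol : clear implicits.
Arguments g_h : clear implicits.
Arguments f_rhs : clear implicits.
Arguments sigma : clear implicits.

(* Main.v *)
Require Import Defs.
From mathcomp Require Import all_boot all_order all_algebra.
From mathcomp Require Import all_classical all_reals all_analysis.
From mathcomp Require Import ring lra ess_sup_inf measurable_realfun.

Import Order.TTheory GRing.Theory Num.Theory.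
Import numFieldNormedType.Exports.

Local Open Scope classical_set_scope.
Local Open Scope ring_scope.

(** Write a(n) = 1 / (n^2 ln n). In Cartesian coordinates u_h is the real part of
    the power series with terms a(n) z^n, hence harmonic in the disc, while u_p
    has Laplacian -1. So the Laplacian of u is -1 and sigma(|Du|) times it is f,
    by the definition of f.

    Smoothness inside: the functions Re (sum of c(n) z^n), with radius of
    convergence at least 1, plus a quadratic polynomial form a family [hpoly]
    stable under partial derivatives ([is_derive_hpoly]); all its members are
    continuous, hence C^k for all k ([Ck_hpoly]). The differentiation of the
    series rests on [is_derive_ulim], the theorem on uniform limits of
    derivatives.

    Boundary: the series of the a(n) converges, so u is continuous up to the
    boundary. The derivative of g_h is a sine series with coefficients
    1 / (n ln n). It is not absolutely convergent, but these coefficients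
    decrease and n times them tends to 0, which is enough for uniform
    convergence ([sine_tail], [ucauchy_sine]); this gives g_h in C^1.

    Viscosity: at a point where a test function touches u, the gradients agree
    and the second derivatives along the axes are ordered
    ([touching_comparison]); since sigma is nonnegative, a classical solution is
    a viscosity solution ([classical_viscosity]).

    Blow-up: on the positive axis the radial derivative is the series with terms
    r^(n-1) / (n ln n), up to the bounded term - r / 2. Its terms are
    nonnegative, and at r = 1 its partial sums dominate ln (ln N) - ln (ln 2)
    ([lnln_le_sum_dcoef]). Hence it tends to +oo, and no continuous extension of
    Du to the closed disc exists. *)

(** * Uniform limits and termwise differentiation *)

Section uniform_limits.
Context {R : realType}.

(** Uniform Cauchy sequences on A; comparing with a single index N, instead of
    with all later pairs, loses only a factor 2. *)
Definition ucauchy {T : Type} (A : set T) (f : nat -> T -> R) : Prop :=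
  forall e : R, 0 < e ->
    exists N, forall n x, (N <= n)%N -> A x -> `|f n x - f N x| <= e.

Lemma limn_dist_le (u : nat -> R) (c e : R) N : cvgn u ->
  (forall n, (N <= n)%N -> `|u n - c| <= e) -> `|limn u - c| <= e.
Proof.
move=> cu H; rewrite ler_distl; apply/andP; split.
- apply: limr_ge => //; near=> n.
  have Nn : (N <= n)%N by near: n; exists N.
  by have := H n Nn; rewrite ler_distl => /andP[].
- apply: limr_le => //; near=> n.
  have Nn : (N <= n)%N by near: n; exists N.
  by have := H n Nn; rewrite ler_distl => /andP[].
Unshelve. all: by end_near. Qed.

Lemma ucauchy_cvg {T : Type} {A : set T} {f : nat -> T -> R} {x : T} :
  ucauchy A f -> A x -> cvgn (f ^~ x).
Proof.
move=> uf Ax; apply/cauchy_cvgP/cauchyP => e e0.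
have e20 : 0 < e / 2 by lra.
have [N HN] := uf _ e20; exists (f N x).
exists N => // n /= Nn; rewrite /ball /= distrC.
apply: le_lt_trans (HN n x Nn Ax) _; lra.
Qed.

Lemma ucauchy_lim {T : Type} {A : set T} {f : nat -> T -> R} (e : R) :
  ucauchy A f -> 0 < e -> exists N, forall n x, (N <= n)%N -> A x ->
    `|limn (f ^~ x) - f n x| <= e.
Proof.
move=> uf e0; have e20 : 0 < e / 2 by lra.
have [N HN] := uf _ e20; exists N => n x Nn Ax.
apply: (@limn_dist_le (f ^~ x) _ _ N); first exact: ucauchy_cvg uf Ax.
move=> m Nm; have := HN n x Nn Ax; have := HN m x Nm Ax.
rewrite !ler_distl; lra.
Qed.

Lemma ucauchyS {T : Type} {A B : set T} {f : nat -> T -> R} :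
  A `<=` B -> ucauchy B f -> ucauchy A f.
Proof.
by move=> AB uf e e0; have [N H] := uf e e0; exists N => n x Nn /AB; exact: H.
Qed.

Lemma ulim_continuous {T : topologicalType} {A : set T} {f : nat -> T -> R} :
  (forall n, {within A, continuous (f n)}) -> ucauchy A f ->
  {within A, continuous (fun x => limn (f ^~ x))}.
Proof.
move=> cf uf; apply/subspace_continuousP => x Ax.
apply/cvgrPdist_le => e e0; have e30 : 0 < e / 3 by lra.
have [N HN] := ucauchy_lim _ uf e30.
have /subspace_continuousP/(_ x Ax)/cvgrPdist_le/(_ _ e30) := cf N.
apply: filterS2 (withinT _ (nbhs_filter x)) => y Ay; rewrite /from_subspace /=.
have := HN N x (leqnn N) Ax; have := HN N y (leqnn N) Ay.
rewrite !ler_distl; lra.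
Qed.

Context {V : normedModType R}.
Implicit Types (d : V -> R) (x v : V).

Lemma is_derive_slice d x v (t l : R) : is_derive (x + t *: v) v d l ->
  is_derive t 1 (fun s : R => d (x + s *: v)) l.
Proof.
suff E : (fun h : R => h^-1 *: (((fun s => d (x + s *: v)) \o shift t) (h *: (1 : R))
      - d (x + t *: v))) =
    (fun h => h^-1 *: ((d \o shift (x + t *: v)) (h *: v) - d (x + t *: v))).
  case=> D L; apply: DeriveDef.
  - by rewrite /derivable E.
  - by rewrite /derive E.
apply/funext => h /=; congr (_ *: (d _ - _)).
by rewrite /shift /= scalerDl [h *: (1 : R)]mulr1 addrCA.
Qed.

(** The mean value inequality; the hypotheses on the symmetric segment |t| <= |h|
    cover both signs of h. *)
Lemma dist_le_derive d (dd : V -> R) x v (h e : R) :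
  (forall t, `|t| <= `|h| -> is_derive (x + t *: v) v d (dd (x + t *: v))) ->
  (forall t, `|t| <= `|h| -> `|dd (x + t *: v)| <= e) ->
  `|d (x + h *: v) - d x| <= e * `|h|.
Proof.
move=> D B.
have D1 (t : R) : `|t| <= `|h| ->
    is_derive t 1 (fun s : R => d (x + s *: v)) (dd (x + t *: v)).
  by move=> th; exact: is_derive_slice (D t th).
have x0 : d x = d (x + (0 : R) *: v) by rewrite scale0r addr0.
have [h0|h0] := leP 0 h.
- have th (t : R) : t \in `[0, h]%R -> `|t| <= `|h|.
    rewrite in_itv /= => /andP[t0 t1]; by rewrite !ger0_norm.
  have [||c cI E] := @MVT_segment R (fun s : R => d (x + s *: v))
      (fun t => dd (x + t *: v)) 0 h h0.
  + by move=> t tI; apply/D1/th; apply: subset_itv_oo_cc tI.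
  + by apply: derivable_within_continuous => t tI; have [] := D1 t (th t tI).
  rewrite x0 E subr0 normrM ler_wpM2r //; exact: B (th c cI).
- have th (t : R) : t \in `[h, 0]%R -> `|t| <= `|h|.
    rewrite in_itv /= => /andP[t0 t1]; by rewrite !ler0_norm ?lerN2 // ltW.
  have [||c cI E] := @MVT_segment R (fun s : R => d (x + s *: v))
      (fun t => dd (x + t *: v)) h 0 (ltW h0).
  + by move=> t tI; apply/D1/th; apply: subset_itv_oo_cc tI.
  + by apply: derivable_within_continuous => t tI; have [] := D1 t (th t tI).
  rewrite distrC x0 E sub0r normrM normrN ler_wpM2r //; exact: B (th c cI).
Qed.

Lemma open_segment (A : set V) x v : open A -> A x ->
  \forall h \near (0 : R)^', forall t : R, `|t| <= `|h| -> A (x + t *: v).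
Proof.
move=> oA Ax.
have C : {for (0 : R), continuous (fun t : R => x + t *: v)}.
  apply: continuousD; first exact: cst_continuous.
  exact: scalel_continuous.
have /C : nbhs (x + (0 : R) *: v) A.
  by rewrite scale0r addr0; exact: open_nbhs_nbhs.
rewrite /= nbhs_filterE => /nbhs_ballP[r /= r0 rA].
near=> h => t th; apply: rA; rewrite /ball /= sub0r normrN.
apply: le_lt_trans th _; near: h.
apply: dnbhs0_lt => //.
Unshelve. all: by end_near. Qed.

(** Termwise differentiation. The mean value inequality applied to f n - f M,
    whose derivative is uniformly small, bounds the difference of the increments
    of f n and f M by e |h| with the same e for all n. Letting n tend to infinity
    compares the increments of the limit with those of the single function f M. *)
Lemma is_derive_ulim {A : set V} {f g : nat -> V -> R} {v} : open A ->
  (forall n x, A x -> is_derive x v (f n) (g n x)) ->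
  (forall x, A x -> cvgn (f ^~ x)) -> ucauchy A g ->
  forall x, A x ->
    is_derive x v (fun y => limn (f ^~ y)) (limn (g ^~ x)).
Proof.
move=> oA D cf ug x Ax; set F := fun y => limn (f ^~ y).
suff H : (h^-1 *: ((F \o shift x) (h *: v) - F x) @[h --> (0 : R)^'])
    --> limn (g ^~ x).
  by apply: DeriveDef; [apply/cvg_ex; eexists; exact: H|exact: cvg_lim H].
apply/cvgrPdist_le => e e0; have e30 : 0 < e / 3 by lra.
have [N2 HN2] := ucauchy_lim _ ug e30.
have e60 : 0 < e / 6 by lra.
have [M1 HM1] := ug _ e60.
have [DN LN] := D (maxn M1 N2) x Ax; set M := maxn M1 N2 in DN LN.
have /cvgrPdist_le/(_ _ e30) : (h^-1 *: ((f M \o shift x) (h *: v) - f M x)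
   @[h --> (0 : R)^']) --> g M x by rewrite -LN; exact: DN.
have := open_segment A x v oA Ax.
apply: filterS3 (nbhs_dnbhs_neq _) => h h0 seg /= Hh.
have Ahx : A (x + h *: v) by exact: seg.
have := HN2 M x (leq_maxr _ _) Ax.
have key : `|(F (x + h *: v) - F x) - (f M (x + h *: v) - f M x)| <= e / 3 * `|h|.
  have -> : F (x + h *: v) - F x = limn (fun n => f n (x + h *: v) - f n x).
    by rewrite limB //; exact: cf.
  apply: (@limn_dist_le _ _ _ M1); first by apply: is_cvgB; exact: cf.
  move=> n Mn.
  have -> : f n (x + h *: v) - f n x - (f M (x + h *: v) - f M x) =
     (f n (x + h *: v) - f M (x + h *: v)) - (f n x - f M x) by ring.
  apply: (@dist_le_derive (fun y => f n y - f M y) (fun y => g n y - g M y)).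
    move=> t th; have At := seg t th.
    by apply: is_deriveB; exact: D.
  move=> t th; have At := seg t th.
  have := HM1 n _ Mn At; have := HM1 M _ (leq_maxl _ _) At.
  rewrite !ler_distl; lra.
move: Hh; rewrite /shift /= ![_ + x]addrC /GRing.scale /=.
set a := f M _ - _ in key *; set b := F _ - _ in key *.
have : `|h^-1 * b - h^-1 * a| <= e / 3.
  rewrite -mulrBr normrM normfV mulrC ler_pdivrMr ?normr_gt0 //.
rewrite !ler_distl; lra.
Qed.

End uniform_limits.

(** * Dominated series and sine series *)

Section series.
Context {R : realType}.

Lemma ucauchy_series {T : Type} (A : set T) (u : nat -> T -> R) :
  (forall e : R, 0 < e -> exists N, forall M x, (N <= M)%N -> A x ->
    `|\sum_(N <= n < M) u n x| <= e) ->
  ucauchy A (fun N x => \sum_(0 <= n < N) u n x).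
Proof.
move=> H e e0; have [N HN] := H e e0; exists N => M x NM Ax.
rewrite (big_cat_nat (leq0n N) NM) /= addrAC subrr add0r; exact: HN.
Qed.

Lemma ucauchy_dominated {T : Type} (A : set T) (u : nat -> T -> R) (c : nat -> R) :
  (forall n x, A x -> `|u n x| <= c n) ->
  (forall e : R, 0 < e -> exists N, forall M, (N <= M)%N ->
     \sum_(N <= n < M) c n <= e) ->
  ucauchy A (fun N x => \sum_(0 <= n < N) u n x).
Proof.
move=> uc H; apply: ucauchy_series => e e0; have [N HN] := H e e0.
exists N => M x NM Ax; apply: le_trans (HN M NM).
apply: le_trans (ler_norm_sum _ _ _) _; apply: ler_sum => n _; exact: uc.
Qed.

Lemma sum_geom_le (q : R) N M : 0 <= q < 1 -> (N <= M)%N ->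
  \sum_(N <= n < M) q ^+ n <= q ^+ N / (1 - q).
Proof.
move=> /andP[q0 q1] NM; rewrite ler_pdivlMr ?subr_gt0 //.
suff -> : (\sum_(N <= n < M) q ^+ n) * (1 - q) = q ^+ N - q ^+ M.
  by rewrite gerBl exprn_ge0.
have := telescope_sumr (fun i => - q ^+ i) NM; rewrite opprK addrC => <-.
rewrite big_distrl /=; apply: eq_bigr => n _; rewrite exprS; ring.
Qed.

(** Each of the n + 1 first terms of the geometric series is at least q ^ n. *)
Lemma mulSn_geom_le (q : R) n : 0 <= q < 1 -> n.+1%:R * q ^+ n <= (1 - q)^-1.
Proof.
move=> /andP[q0 q1]; have := @sum_geom_le q 0 n.+1; rewrite q0 q1 => /(_ isT isT).
rewrite expr0 mul1r; apply: le_trans.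
have -> : n.+1%:R * q ^+ n = \sum_(0 <= i < n.+1) q ^+ n.
  by rewrite sumr_const_nat subn0 mulr_natl.
rewrite !big_nat; apply: ler_sum => i /andP[_ ilt].
by apply: ler_wiXn2l; rewrite // ltW.
Qed.

(** Summation by parts. The partial sum corrected by its boundary term
    b (m + k) T (m + k) grows by at most b i - b i.+1 at each step, which
    telescopes. *)
Lemma abel_bound (b T : nat -> R) m k :
  (forall n, (m <= n)%N -> 0 <= b n) ->
  (forall n, (m <= n)%N -> b n.+1 <= b n) ->
  (forall n, `|T n| <= 1) ->
  `|\sum_(m <= n < m + k) b n * (T n - T n.+1)| <= 2 * b m.
Proof.
move=> b0 bd T1.
have bT i j : (m <= i)%N -> `|b i * T j| <= b i.
  by move=> mi; rewrite normrM ger0_norm ?b0 // ler_piMr ?b0.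
suff H : `|\sum_(m <= n < m + k) b n * (T n - T n.+1) + b (m + k)%N * T (m + k)%N|
    <= 2 * b m - b (m + k)%N.
  have := bT (m + k)%N (m + k)%N (leq_addr _ _).
  by move: H; rewrite !ler_norml; lra.
elim: k => [|k IH].
  by rewrite addn0 big_geq // add0r; have := bT m m (leqnn m); lra.
rewrite addnS big_nat_recr ?leq_addr //=.
have := bd (m + k)%N (leq_addr _ _); set i := (m + k)%N in IH *.
set S := bigop _ _ _ in IH * => bi.
have : `|(b i - b i.+1) * T i.+1| <= b i - b i.+1.
  by rewrite normrM ger0_norm ?subr_ge0 // ler_piMr ?subr_ge0.
move: IH; rewrite !ler_norml !mulrBr !mulrBl; lra.
Qed.

Lemma norm_sin_muln (t : R) n : `|sin (n%:R * t)| <= 2 * n%:R * `|sin (t / 2)|.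
Proof.
elim: n => [|n IH]; first by rewrite mul0r sin0 normr0 mulr0 mul0r.
have -> : n.+1%:R * t = n%:R * t + t by rewrite -natr1; ring.
have -> : 2 * n.+1%:R * `|sin (t / 2)| =
    2 * n%:R * `|sin (t / 2)| + 2 * `|sin (t / 2)| by rewrite -natr1; ring.
rewrite sinD.
have cle (x : R) : `|cos x| <= 1 by rewrite ler_norml cos_geN1 cos_le1.
apply: le_trans (ler_normD _ _) _; apply: lerD.
  by rewrite normrM; apply: le_trans IH; rewrite ler_piMr.
rewrite normrM; apply: (@le_trans _ _ `|sin t|); first by rewrite ler_piMl.
have -> : sin t = cos (t / 2) * sin (t / 2) *+ 2.
  by rewrite -sin_mulr2n; congr sin; field.
by rewrite normrMn normrM -[X in X <= _]mulr_natl ler_wpM2l // ler_piMl.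
Qed.

Lemma sin_abel (t : R) n : 2 * sin (t / 2) * sin (n%:R * t) =
  cos (n%:R * t - t / 2) - cos (n.+1%:R * t - t / 2).
Proof.
have -> : n.+1%:R * t - t / 2 = n%:R * t + t / 2 by rewrite -natr1; field.
rewrite cosB cosD; ring.
Qed.

(** The Chaundy-Jolliffe bound, uniform in t: a sine series with nonincreasing
    coefficients has tails controlled by the size of n b(n). With
    s = |sin (t / 2)|, the terms with n <= 1/s are estimated one by one using
    |sin (n t)| <= 2 n s, and the terms with n > 1/s by summation by parts. *)
Lemma sine_tail (b : nat -> R) (e t : R) N M : (0 < N)%N -> (N <= M)%N ->
  (forall n, (N <= n)%N -> 0 <= b n) ->
  (forall n, (N <= n)%N -> b n.+1 <= b n) ->
  (forall n, (N <= n)%N -> n%:R * b n <= e) ->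
  `|\sum_(N <= n < M) b n * sin (n%:R * t)| <= 3 * e.
Proof.
move=> N0 NM b0 bd be; set s := `|sin (t / 2)|.
have s0 : 0 <= s by exact: normr_ge0.
have e0 : 0 <= e by apply: le_trans (be N (leqnn N)); rewrite mulr_ge0 ?b0.
(* at most 1/s terms, each of size at most 2 s e *)
have head P : (N <= P)%N -> P.-1%:R * s <= 1 ->
    `|\sum_(N <= n < P) b n * sin (n%:R * t)| <= 2 * e.
  move=> NP Ps; apply: le_trans (ler_norm_sum _ _ _) _.
  apply: (@le_trans _ _ (\sum_(N <= n < P) 2 * e * s)).
    rewrite !big_nat; apply: ler_sum => n /andP[Nn _].
    rewrite normrM ger0_norm ?b0 //.
    apply: le_trans (ler_wpM2l (b0 n Nn) (norm_sin_muln t n)) _.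
    rewrite -/s mulrA; apply: ler_wpM2r => //.
    by have := be n Nn; rewrite mulrA [b n * 2]mulrC -mulrA [b n * _]mulrC => ?; lra.
  rewrite sumr_const_nat -[X in X <= _]mulr_natr -mulrA ler_piMr ?mulr_ge0 //.
  apply: le_trans Ps; rewrite mulrC ler_wpM2r // ler_nat.
  by rewrite -subn1 leq_sub2l.
(* summation by parts bounds the sum by b P / s <= P * b P *)
have tail P : (N <= P)%N -> (P <= M)%N -> 1 <= P%:R * s ->
    `|\sum_(P <= n < M) b n * sin (n%:R * t)| <= e.
  move=> NP PM Ps.
  have bP : 0 <= b P by exact: b0.
  have H : `|2 * sin (t / 2) * (\sum_(P <= n < M) b n * sin (n%:R * t))| <= 2 * b P.
    pose T n := cos (n%:R * t - t / 2).
    have -> : 2 * sin (t / 2) * (\sum_(P <= n < M) b n * sin (n%:R * t)) =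
        \sum_(P <= n < P + (M - P)) b n * (T n - T n.+1).
      rewrite subnKC // mulr_sumr; apply: eq_bigr => n _.
      by rewrite -sin_abel; ring.
    apply: abel_bound => n; first by move=> Pn; apply/b0/(leq_trans NP).
      by move=> Pn; apply/bd/(leq_trans NP).
    by rewrite ler_norml cos_geN1 cos_le1.
  move: H; rewrite !normrM ger0_norm // -/s -mulrA ler_pM2l // => H.
  apply: le_trans (be P NP); apply: (@le_trans _ _ (P%:R * (s * `|\sum_(P <= n < M) b n * sin (n%:R * t)|))).
    by rewrite mulrA ler_peMl.
  by rewrite ler_wpM2l.
have [sz|sn0] := eqVneq s 0.
  by apply: le_trans (head M NM _) _; [rewrite sz mulr0|lra].
have {sn0}s_gt0 : 0 < s by rewrite lt_neqAle eq_sym sn0.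
set m := (Num.truncn s^-1).+1.
have sV : 0 <= s^-1 by rewrite invr_ge0.
have mlo : m.-1%:R * s <= 1.
  by rewrite -ler_pdivlMr // div1r /= truncn_le.
have mhi : 1 <= m%:R * s.
  by rewrite -ler_pdivrMr // div1r ltW // truncnS_gt.
have [Mm|mM] := leqP M m.
  apply: le_trans (head M NM _) _; last lra.
  apply: le_trans mlo; rewrite ler_wpM2r // ler_nat.
  by rewrite -!subn1 leq_sub2r.
have [mN|Nm] := leqP m N.
  apply: le_trans (tail N (leqnn N) NM _) _; last lra.
  by apply: le_trans mhi _; rewrite ler_wpM2r // ler_nat.
rewrite (big_cat_nat (ltnW Nm) (ltnW mM)) /=.
apply: le_trans (ler_normD _ _) _.
have := head m (ltnW Nm) mlo; have := tail m (ltnW Nm) (ltnW mM) mhi; lra.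
Qed.

End series.

(** * The coefficients 1 / (n^2 ln n) *)

Section coefficients.
Context {R : realType}.

(** The coefficients of the cosine series. Since 0^-1 = 0 by
    convention, the terms of index 0 and 1 vanish, so that the series can be
    summed from 0. *)
Definition coef (n : nat) : R := (n%:R ^+ 2 * ln n%:R)^-1.

(** The coefficients of the differentiated series, equal to n * coef n. *)
Definition dcoef (n : nat) : R := (n%:R * ln n%:R)^-1.

Lemma ln_nat_gt0 n : (2 <= n)%N -> 0 < ln (n%:R : R).
Proof. by move=> n2; rewrite ln_gt0 // ltr1n. Qed.

Lemma ln_nat_le m n : (1 <= m)%N -> (m <= n)%N -> ln (m%:R : R) <= ln n%:R.
Proof.
by move=> m0 mn; rewrite ler_ln ?posrE ?ltr0n ?ler_nat // (leq_trans m0).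
Qed.

Lemma coef_lt2 n : (n < 2)%N -> coef n = 0.
Proof.
by case: n => [|[|]] // _; rewrite /coef ?ln1 ?mulr0 ?expr0n ?mul0r invr0.
Qed.

Lemma dcoef_lt2 n : (n < 2)%N -> dcoef n = 0.
Proof. by case: n => [|[|]] // _; rewrite /dcoef ?ln1 ?mulr0 ?mul0r invr0. Qed.

Lemma coef_ge0 n : 0 <= coef n.
Proof.
have [/coef_lt2->//|n2] := ltnP n 2.
by rewrite invr_ge0 mulr_ge0 ?exprn_ge0 // ltW // ln_nat_gt0.
Qed.

Lemma dcoef_ge0 n : 0 <= dcoef n.
Proof.
have [/dcoef_lt2->//|n2] := ltnP n 2.
by rewrite invr_ge0 mulr_ge0 // ltW // ln_nat_gt0.
Qed.

Lemma muln_coef n : n%:R * coef n = dcoef n.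
Proof.
case: n => [|n]; first by rewrite mul0r dcoef_lt2.
by rewrite /coef /dcoef expr2 -mulrA invfM mulrA mulfV ?mul1r // pnatr_eq0.
Qed.

Lemma coef_le_telescope m : (0 < m)%N ->
  coef m.+1 <= (ln 2)^-1 * (m%:R^-1 - m.+1%:R^-1).
Proof.
move=> m0; have l2 : 0 < ln (2 : R) by exact: (ln_nat_gt0 2).
have mR : 0 < (m%:R : R) by rewrite ltr0n.
have sR : 0 < (m.+1%:R : R) by rewrite ltr0n.
have -> : (m%:R : R)^-1 - m.+1%:R^-1 = (m.+1%:R * m%:R)^-1.
  rewrite -natr1 in sR *; field; apply/andP; split; exact: lt0r_neq0.
rewrite -invfM /coef lef_pV2 ?posrE; last 2 first.
- by rewrite mulr_gt0 // ?exprn_gt0 // ln_nat_gt0.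
- by rewrite !mulr_gt0.
rewrite [leLHS]mulrC ler_pM //.
- exact: ltW.
- by rewrite expr2 ler_pM2l // ler_nat.
- exact: ln_nat_le.
Qed.

Lemma coef_le n : coef n <= (ln 2)^-1.
Proof.
have l2 : 0 < ln (2 : R) by exact: (ln_nat_gt0 2).
case: n => [|[|n]]; try by rewrite coef_lt2 // invr_ge0 ltW.
apply: le_trans (coef_le_telescope n.+1 _) _ => //.
apply: ler_piMr; first by rewrite invr_ge0 ltW.
apply: (@le_trans _ _ n.+1%:R^-1); first by rewrite gerBl invr_ge0.
by rewrite invf_le1 ?ltr0n // ler1n.
Qed.

Lemma coef_tail (e : R) : 0 < e -> exists N, forall M, (N <= M)%N ->
  \sum_(N <= n < M) coef n <= e.
Proof.
move=> e0; have l2 : 0 < ln (2 : R) by exact: (ln_nat_gt0 2).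
pose N := (Num.truncn (ln 2 * e)^-1).+1.
have NR : 0 < (N%:R : R) by rewrite ltr0n.
exists N.+1 => -[//|M] NM; rewrite big_add1 /=.
apply: (@le_trans _ _ (\sum_(N <= m < M) (ln 2)^-1 * (m%:R^-1 - m.+1%:R^-1))).
  rewrite !big_nat; apply: ler_sum => m /andP[Nm _].
  by apply: coef_le_telescope; exact: leq_trans Nm.
rewrite -mulr_sumr.
have -> : \sum_(N <= m < M) (m%:R^-1 - m.+1%:R^-1) = N%:R^-1 - M%:R^-1 :> R.
  rewrite -[RHS]opprB -(telescope_sumr (fun m => (m%:R : R)^-1)) //.
  by rewrite -sumrN; apply: eq_bigr => m _; rewrite opprB.
apply: (@le_trans _ _ ((ln 2)^-1 * N%:R^-1)).
  by rewrite ler_pM2l ?invr_gt0 // gerBl invr_ge0.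
rewrite -invfM -[e]invrK lef_pV2 ?posrE ?invr_gt0 ?mulr_gt0 //.
have := truncnS_gt (ln 2 * e)^-1; rewrite -/N invfM => /ltW.
by rewrite mulrC ler_pdivrMr // mulrC.
Qed.

Lemma dcoef_nonincreasing n : (2 <= n)%N -> dcoef n.+1 <= dcoef n.
Proof.
move=> n2; have l := ln_nat_gt0 n n2.
have n0 : 0 < (n%:R : R) by rewrite ltr0n ltnW.
rewrite /dcoef lef_pV2 ?posrE ?mulr_gt0 ?ln_nat_gt0 ?ltr0n // 1?ltnW //.
by rewrite ler_pM ?ler_nat ?(ltW l) // ln_nat_le // ltnW.
Qed.

(** Here n * dcoef n = 1 / ln n tends to 0, which is exactly what the uniform
    bound on the tails of sine series requires; the series of the coefficients
    themselves diverges, so domination is not available. *)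
Lemma ucauchy_sine : ucauchy [set: R]
  (fun N t => \sum_(0 <= n < N) dcoef n * sin (n%:R * t)).
Proof.
apply: (@ucauchy_series _ _ setT (fun n t => dcoef n * sin (n%:R * t))) => e e0.
pose N := (Num.truncn (expR (3 / e))).+2.
have lN : 3 / e <= ln (N%:R : R).
  rewrite -[leLHS]expRK ler_ln ?posrE ?expR_gt0 ?ltr0n //.
  apply: ltW; apply: lt_le_trans (truncnS_gt _) _; by rewrite ler_nat.
have l0 : 0 < ln (N%:R : R) by exact: ln_nat_gt0.
exists N => M t NM _.
apply: (@le_trans _ _ (3 * (ln N%:R)^-1)); last first.
  by rewrite ler_pdivrMr // mulrC -ler_pdivrMr.
apply: sine_tail => // n Nn; first exact: dcoef_ge0.
  by apply: dcoef_nonincreasing; exact: leq_trans Nn.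
have nR : 0 < (n%:R : R) by rewrite ltr0n; apply: leq_trans Nn.
rewrite /dcoef invfM mulrA mulfV ?gt_eqF // mul1r lef_pV2 ?posrE ?ln_nat_le //.
by apply: lt_le_trans l0 _; exact: ln_nat_le.
Qed.

(** Applying ln (1 + x) <= x twice gives
    ln (ln (n + 1)) - ln (ln n) <= 1 / (n ln n), and the left side telescopes. *)
Lemma lnln_le_sum_dcoef N : (2 <= N)%N ->
  ln (ln (N%:R : R)) - ln (ln 2) <= \sum_(0 <= n < N) dcoef n.
Proof.
elim: N => // N IH; rewrite leq_eqVlt => /predU1P[<-|]; last rewrite ltnS => N2.
  by rewrite subrr sumr_ge0 // => n _; exact: dcoef_ge0.
rewrite big_nat_recr //=; apply: (@le_trans _ _ (ln (ln N%:R) - ln (ln 2) + dcoef N)).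
  have l := ln_nat_gt0 N N2; have n0 : 0 < (N%:R : R) by rewrite ltr0n ltnW.
  have iN : 0 <= (N%:R : R)^-1 by rewrite invr_ge0 ltW.
  have i1 : 0 < 1 + (N%:R : R)^-1 by rewrite ltr_pwDl.
  have d1 : 0 <= ln (1 + (N%:R : R)^-1) by rewrite ln_ge0 // lerDl.
  have d2 : ln (1 + (N%:R : R)^-1) <= N%:R^-1 by apply: le_ln1Dx; lra.
  have E : ln (N.+1%:R : R) = ln N%:R * (1 + ln (1 + N%:R^-1) / ln N%:R).
    rewrite mulrDr mulr1 mulrCA mulfV ?gt_eqF // mulr1 -lnM ?posrE //.
    by rewrite mulrDr mulr1 mulfV ?gt_eqF // natr1.
  rewrite E lnM ?posrE //; last by rewrite ltr_wpDr ?divr_ge0 // ltW.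
  have q0 : 0 <= ln (1 + (N%:R : R)^-1) / ln N%:R by rewrite divr_ge0 // ltW.
  have : ln (1 + ln (1 + (N%:R : R)^-1) / ln N%:R) <= dcoef N.
    apply: le_trans (le_ln1Dx _) _; first lra.
    by rewrite /dcoef invfM ler_wpM2r // invr_ge0 ltW.
  lra.
by rewrite lerD2r IH.
Qed.

Lemma sum_dcoef_unbounded (M : R) : exists N, M <= \sum_(0 <= n < N) dcoef n.
Proof.
pose x : R := expR (expR (M + ln (ln 2))).
pose N := (Num.truncn x).+2; exists N.
apply: le_trans (lnln_le_sum_dcoef N _) => //.
rewrite lerBrDr -[leLHS]expRK ler_ln ?posrE ?expR_gt0 ?ln_nat_gt0 //.
rewrite -[leLHS]expRK ler_ln ?posrE ?expR_gt0 ?ltr0n //.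
by apply: ltW; apply: lt_le_trans (truncnS_gt _) _; rewrite ler_nat.
Qed.

End coefficients.

(** * The Euclidean plane and complex powers *)

Section plane.
Context {R : realType}.
Implicit Types (p : R * R) (a b : nat -> R).

Lemma enorm_ge0 p : 0 <= enorm p.
Proof. exact: sqrtr_ge0. Qed.

Lemma sqr_enorm p : enorm p ^+ 2 = p.1 ^+ 2 + p.2 ^+ 2.
Proof. by rewrite sqr_sqrtr // addr_ge0 // sqr_ge0. Qed.

Lemma fst_le_enorm p : `|p.1| <= enorm p.
Proof. by rewrite -sqrtr_sqr ler_wsqrtr // lerDl sqr_ge0. Qed.

Lemma enorm_polar (r t : R) : 0 <= r -> enorm (r * cos t, r * sin t) = r.
Proof.
move=> r0; rewrite /enorm /= !exprMn -mulrDr cos2Dsin2 mulr1 sqrtr_sqr.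
exact: ger0_norm.
Qed.

(** The function angle is a polar angle; at the origin both sides are 0. *)
Lemma angleP p :
  p = (enorm p * cos (angle p), enorm p * sin (angle p)).
Proof.
have [p0|p0] := eqVneq (enorm p) 0.
  have := sqr_enorm p; rewrite p0 expr0n /= => /esym/eqP.
  rewrite paddr_eq0 ?sqr_ge0 // !sqrf_eq0 => /andP[/eqP x0 /eqP y0].
  by rewrite !mul0r; case: p x0 y0 {p0} => x y /= -> ->.
have n0 : 0 < enorm p by rewrite lt_neqAle eq_sym p0 enorm_ge0.
have b1 : -1 <= p.1 / enorm p <= 1.
  by rewrite -ler_norml normrM normfV (ger0_norm (enorm_ge0 p)) ler_pdivrMr //
     mul1r fst_le_enorm.
have c : cos (angle p) = p.1 / enorm p.
  by rewrite /angle; case: ifP => _; rewrite ?cosN acosK // in_itv.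
have s0 : sin (acos (p.1 / enorm p)) = `|p.2| / enorm p.
  have -> : `|p.2| / enorm p = `|p.2 / enorm p|.
    by rewrite normrM normfV (ger0_norm (enorm_ge0 p)).
  rewrite sin_acos // -sqrtr_sqr; congr Num.sqrt.
  have := sqr_enorm p; set q := enorm p in n0 * => qE.
  rewrite !expr_div_n qE; field; rewrite -qE expf_eq0 /=; exact: lt0r_neq0.
have s : sin (angle p) = p.2 / enorm p.
  rewrite /angle; case: leP => h; rewrite ?sinN s0.
    by rewrite ger0_norm.
  by rewrite ltr0_norm // mulNr opprK.
by rewrite c s ![enorm p * _]mulrC !divfK //; case: p {n0 b1 c s0 s p0}.
Qed.

(** The powers z ^ n of z = x + i y, as pairs (Re, Im). *)
Fixpoint zpow (n : nat) p : R * R :=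
  if n is m.+1 then
    (p.1 * (zpow m p).1 - p.2 * (zpow m p).2,
     p.1 * (zpow m p).2 + p.2 * (zpow m p).1)
  else (1, 0).

Lemma zpow_polar n (r t : R) : zpow n (r * cos t, r * sin t) =
  (r ^+ n * cos (n%:R * t), r ^+ n * sin (n%:R * t)).
Proof.
elim: n => [|n /= ->] /=; first by rewrite mul0r cos0 sin0 expr0 mulr1 mulr0.
have -> : n.+1%:R * t = n%:R * t + t by rewrite -natr1; ring.
by rewrite cosD sinD exprS; congr pair; ring.
Qed.

Lemma zpow_le n p :
  `|(zpow n p).1| <= enorm p ^+ n /\ `|(zpow n p).2| <= enorm p ^+ n.
Proof.
rewrite {1 3}(angleP p) zpow_polar /= !normrM.
rewrite ger0_norm ?exprn_ge0 ?enorm_ge0 //.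
by split; rewrite ler_piMr ?exprn_ge0 ?enorm_ge0 // ler_norml
  ?cos_geN1 ?cos_le1 ?sin_geN1 ?sin_le1.
Qed.

Lemma is_derive_fst p v : is_derive p v (fst : R * R -> R) v.1.
Proof.
have H : (h^-1 *: ((fst \o shift p) (h *: v) - fst p) @[h --> (0 : R)^']) --> v.1.
  apply: cvg_near_cst; near=> h.
  have h0 : h != 0 by near: h; exact: nbhs_dnbhs_neq.
  by rewrite /= addrK scalerA mulVf // scale1r.
by apply: DeriveDef; [apply/cvg_ex; eexists; exact: H|exact: cvg_lim H].
Unshelve. all: by end_near. Qed.

Lemma is_derive_snd p v : is_derive p v (snd : R * R -> R) v.2.
Proof.
have H : (h^-1 *: ((snd \o shift p) (h *: v) - snd p) @[h --> (0 : R)^']) --> v.2.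
  apply: cvg_near_cst; near=> h.
  have h0 : h != 0 by near: h; exact: nbhs_dnbhs_neq.
  by rewrite /= addrK scalerA mulVf // scale1r.
by apply: DeriveDef; [apply/cvg_ex; eexists; exact: H|exact: cvg_lim H].
Unshelve. all: by end_near. Qed.

(** The directional derivative of z ^ n along v is n v z ^ (n - 1), a complex
    product. *)
Lemma is_derive_zpow n p v :
  is_derive p v (fun q => (zpow n q).1)
    (n%:R * (v.1 * (zpow n.-1 p).1 - v.2 * (zpow n.-1 p).2)) /\
  is_derive p v (fun q => (zpow n q).2)
    (n%:R * (v.1 * (zpow n.-1 p).2 + v.2 * (zpow n.-1 p).1)).
Proof.
elim: n => [|n [IH1 IH2]]; first by rewrite !mul0r; split; exact: is_derive_cst.
have D1 := is_derive_fst p v; have D2 := is_derive_snd p v.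
split => /=.
- apply: is_derive_eq (is_deriveB (is_deriveM D1 IH1) (is_deriveM D2 IH2)) _.
  rewrite /GRing.scale /= -natr1.
  by case: n {IH1 IH2} => [|n] /=; ring.
- apply: is_derive_eq (is_deriveD (is_deriveM D1 IH2) (is_deriveM D2 IH1)) _.
  rewrite /GRing.scale /= -natr1.
  by case: n {IH1 IH2} => [|n] /=; ring.
Qed.

Lemma continuous_zpow n :
  continuous (fun q => (zpow n q).1) /\ continuous (fun q => (zpow n q).2).
Proof.
elim: n => [|n [IH1 IH2]]; first by split; exact: cst_continuous.
split => q /=.
- by apply: cvgB; apply: cvgM; [exact: cvg_fst|exact: IH1|exact: cvg_snd|exact: IH2].
- by apply: cvgD; apply: cvgM; [exact: cvg_fst|exact: IH2|exact: cvg_snd|exact: IH1].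
Qed.

Lemma continuous_enorm : continuous (@enorm R).
Proof.
move=> p; apply: (@continuous_comp _ _ _ (fun q : R * R => q.1 ^+ 2 + q.2 ^+ 2)).
  apply: continuousD; apply: (@continuous_comp _ _ _ _ (fun x : R => x ^+ 2));
    try exact: exprn_continuous; [exact: cvg_fst|exact: cvg_snd].
exact: sqrt_continuous.
Qed.

Lemma open_disc (r : R) : open [set p | enorm p < r].
Proof.
apply: (open_comp _ (@open_lt R r)) => p _; exact: continuous_enorm.
Qed.

Lemma closed_disc (r : R) : closed [set p | enorm p <= r].
Proof.
apply: (preimage_closed (f := @enorm R) _ (@closed_le R r)) => p _.
exact: continuous_enorm.
Qed.

End plane.

(** * Harmonic power series in the disc *)

Section power_series.
Context {R : realType}.
Implicit Types (p v : R * R) (a b : nat -> R) (D : set (R * R)).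

(** The partial sums of Re (\sum (a n - i b n) z ^ n). Both families of
    coefficients are needed, because differentiation in y exchanges them. *)
Definition hsum a b (N : nat) p : R :=
  \sum_(0 <= n < N) (a n * (zpow n p).1 + b n * (zpow n p).2).

Definition harm a b p : R := limn (hsum a b ^~ p).

(** The coefficients of the derivative of a power series. *)
Definition dshift a (n : nat) : R := n.+1%:R * a n.+1.

(** The radius of convergence is at least 1, expressed by bounded terms because
    this form passes easily to derivatives. *)
Definition radius1 a : Prop := forall r : R, 0 < r < 1 ->
  exists B, forall n, `|a n| * r ^+ n <= B.

(** The factor n + 1 is absorbed by passing from r to a larger radius s < 1. *)
Lemma radius1_dshift a : radius1 a -> radius1 (dshift a).
Proof.
move=> ra r /andP[r0 r1]; have [s /andP[rs s1]] : exists s, r < s < 1 by exists ((1 + r) / 2); lra.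
have s0 : 0 < s by exact: lt_trans rs.
have [|B HB] := ra s; first by rewrite s0.
exists (B * s^-1 * (1 - r / s)^-1) => n.
have q : 0 <= r / s < 1.
  by rewrite divr_ge0 ?(ltW r0) ?(ltW s0) //= ltr_pdivrMr // mul1r.
have -> : `|dshift a n| * r ^+ n =
    (`|a n.+1| * s ^+ n.+1) * s^-1 * (n.+1%:R * (r / s) ^+ n).
  rewrite /dshift normrM ger0_norm // exprS expr_div_n.
  by field; rewrite expf_neq0 gt_eqF.
apply: ler_pM (mulSn_geom_le _ n q).
- by rewrite !mulr_ge0 ?exprn_ge0 ?invr_ge0 // ltW.
- by rewrite mulr_ge0 // exprn_ge0 //; case/andP: q.
- by rewrite ler_pM2r ?invr_gt0.
Qed.

Lemma ucauchy_hsum a b (r : R) : radius1 a -> radius1 b -> 0 < r < 1 ->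
  ucauchy [set p | enorm p <= r] (hsum a b).
Proof.
move=> ra rb /andP[r0 r1]; have [s /andP[rs s1]] : exists s, r < s < 1 by exists ((1 + r) / 2); lra.
have s0 : 0 < s by exact: lt_trans rs.
have [|A HA] := ra s; first by rewrite s0.
have [|B HB] := rb s; first by rewrite s0.
pose C := `|A| + `|B| + 1; pose q := r / s.
have C0 : 0 < C by rewrite ltr_wpDl // addr_ge0.
have q0 : 0 <= q by rewrite divr_ge0 // ltW.
have q1 : q < 1 by rewrite ltr_pdivrMr // mul1r.
apply: (@ucauchy_dominated _ _ _ (fun n p => a n * (zpow n p).1 + b n * (zpow n p).2)
   (fun n => C * q ^+ n)) => [n p /= pr|e e0].
  have [z1 z2] := zpow_le n p.
  have pn : enorm p ^+ n <= r ^+ n by rewrite lerXn2r ?nnegrE ?enorm_ge0 // ltW.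
  have rE : r ^+ n = s ^+ n * q ^+ n by rewrite -exprMn mulrC divfK ?gt_eqF.
  apply: le_trans (ler_normD _ _) _; rewrite !normrM.
  apply: (@le_trans _ _ (`|a n| * r ^+ n + `|b n| * r ^+ n)).
    by apply: lerD; rewrite ler_wpM2l // (le_trans _ pn).
  rewrite rE !mulrA -mulrDl ler_wpM2r ?exprn_ge0 //.
  have := HA n; have := HB n; have := ler_norm A; have := ler_norm B.
  by rewrite /C; lra.
have [N HN] : exists N, q ^+ N <= e * (1 - q) / C.
  have d0 : 0 < e * (1 - q) / C by rewrite divr_gt0 // mulr_gt0 // subr_gt0.
  have /cvgrPdist_le/(_ _ d0)[N _ H] : (fun n => q ^+ n) @ \oo --> (0 : R).
    by apply: cvg_expr; rewrite ger0_norm.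
  exists N; have := H N (leqnn N).
  by rewrite /= sub0r normrN ger0_norm // exprn_ge0.
exists N => M NM; rewrite -mulr_sumr.
apply: le_trans (ler_wpM2l (ltW C0) (@sum_geom_le _ q N M _ NM)) _.
  by rewrite q0.
rewrite mulrA ler_pdivrMr ?subr_gt0 // mulrC -ler_pdivlMr //.
Qed.

Lemma disc_between p : enorm p < 1 -> exists2 r : R, 0 < r < 1 & enorm p < r.
Proof.
move=> p1; exists ((1 + enorm p) / 2); have := enorm_ge0 p; first by lra.
by move=> _; lra.
Qed.

Lemma cvgn_hsum a b p : radius1 a -> radius1 b -> enorm p < 1 ->
  cvgn (hsum a b ^~ p).
Proof.
move=> ra rb /disc_between[r r01 pr].
by apply: ucauchy_cvg (ucauchy_hsum _ _ r ra rb r01) (ltW pr).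
Qed.

Lemma hsum0 a b : hsum a b 0 = cst 0.
Proof. by apply/funext => q; rewrite /hsum big_geq. Qed.

Lemma hsumS a b N : hsum a b N.+1 =
  (fun q => hsum a b N q + (a N * (zpow N q).1 + b N * (zpow N q).2)).
Proof. by apply/funext => q; rewrite /hsum big_nat_recr. Qed.

(** The new coefficients are the product of v.1 + i v.2 and a' - i b', where the
    prime is dshift; the constant term disappears and the other degrees drop by
    one, whence the index N.-1. *)
Lemma is_derive_hsum a b N p v : is_derive p v (hsum a b N)
  (hsum (fun n => v.1 * dshift a n + v.2 * dshift b n)
        (fun n => v.1 * dshift b n - v.2 * dshift a n) N.-1 p).
Proof.
suff H : is_derive p v (hsum a b N)
    (\sum_(0 <= n < N) (a n * (n%:R * (v.1 * (zpow n.-1 p).1 - v.2 * (zpow n.-1 p).2))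
      + b n * (n%:R * (v.1 * (zpow n.-1 p).2 + v.2 * (zpow n.-1 p).1)))).
  apply: is_derive_eq H _; case: N => [|N]; first by rewrite /hsum !big_geq.
  rewrite big_nat_recl //= !mul0r !mulr0 !add0r.
  by apply: eq_bigr => n _ /=; rewrite /dshift; ring.
elim: N => [|N IH].
  by rewrite big_geq // hsum0; exact: is_derive_cst.
rewrite big_nat_recr //= hsumS; have [D1 D2] := is_derive_zpow N p v.
exact: is_deriveD IH (is_deriveD (is_deriveZ (a N) D1) (is_deriveZ (b N) D2)).
Qed.

Lemma radius1_comb (s t : R) a b : radius1 a -> radius1 b ->
  radius1 (fun n => s * a n + t * b n).
Proof.
move=> ra rb r r01; have [A HA] := ra r r01; have [B HB] := rb r r01.
have r0 : 0 <= r by case/andP: r01 => /ltW.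
exists (`|s| * A + `|t| * B) => n.
apply: (@le_trans _ _ (`|s| * (`|a n| * r ^+ n) + `|t| * (`|b n| * r ^+ n))).
  rewrite !mulrA -mulrDl ler_wpM2r ?exprn_ge0 // -!normrM; exact: ler_normD.
by apply: lerD; rewrite ler_wpM2l.
Qed.

Lemma is_derive_harm a b p v : radius1 a -> radius1 b -> enorm p < 1 ->
  is_derive p v (harm a b)
  (harm (fun n => v.1 * dshift a n + v.2 * dshift b n)
        (fun n => v.1 * dshift b n + (- v.2) * dshift a n) p).
Proof.
move=> ra rb p1; have [r r01 pr] := disc_between p p1.
set a' := fun n => _; set b' := fun n => _ + _ * dshift a n.
have ra' : radius1 a' by apply: radius1_comb; exact: radius1_dshift.
have rb' : radius1 b' by apply: radius1_comb; exact: radius1_dshift.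
have -> : harm a' b' p = limn (fun N => hsum a' b' N.-1 p).
  apply/esym/cvg_lim => //; rewrite -cvg_shiftS; exact: cvgn_hsum.
have r1 : r < 1 by case/andP: r01.
apply: (is_derive_ulim (A := [set q | enorm q < r]) (g := fun N => hsum a' b' N.-1)) => //.
- exact: open_disc.
- move=> n q _; apply: is_derive_eq (is_derive_hsum a b n q v) _.
  by congr hsum; apply/funext => k; rewrite /b' mulNr.
- by move=> q qr; apply: cvgn_hsum => //; exact: lt_trans qr r1.
- move=> e e0; have [N HN] := ucauchy_hsum _ _ r ra' rb' r01 e e0.
  by exists N.+1 => -[//|n] q; rewrite ltnS => Nn /ltW; exact: HN.
Qed.

Lemma continuous_hsum a b N : continuous (hsum a b N).
Proof.
elim: N => [|N IH].
  by rewrite hsum0; exact: cst_continuous.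
rewrite hsumS; have [C1 C2] := @continuous_zpow R N.
move=> q; apply: cvgD; first exact: IH.
by apply: cvgD; apply: cvgM; [exact: cvg_cst|exact: C1|exact: cvg_cst|exact: C2].
Qed.

Lemma continuous_harm a b p : radius1 a -> radius1 b -> enorm p < 1 ->
  {for p, continuous (harm a b)}.
Proof.
move=> ra rb /disc_between[r r01 pr].
have : {within [set q | enorm q < r], continuous (harm a b)}.
  apply: ulim_continuous => [n|].
    by apply: continuous_subspaceT; exact: continuous_hsum.
  by apply: ucauchyS (ucauchy_hsum _ _ r ra rb r01) => q /ltW.
rewrite continuous_open_subspace; last exact: open_disc.
by apply; rewrite inE.
Qed.

(** A harmonic power series plus a quadratic polynomial with radial second
    order part. This family contains the solution and is stable under partial
    derivatives, which gives smoothness by induction. *)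
Definition hpoly a b (c : R * R * R * R) p : R :=
  let: (c0, c1, c2, c3) := c in
  harm a b p + (c0 + c1 * p.1 + c2 * p.2 + c3 * (p.1 ^+ 2 + p.2 ^+ 2)).

Lemma is_derive_hpoly a b c0 c1 c2 c3 p v : radius1 a -> radius1 b -> enorm p < 1 ->
  is_derive p v (hpoly a b (c0, c1, c2, c3))
   (hpoly (fun n => v.1 * dshift a n + v.2 * dshift b n)
         (fun n => v.1 * dshift b n + (- v.2) * dshift a n)
         (v.1 * c1 + v.2 * c2, 2 * v.1 * c3, 2 * v.2 * c3, 0) p).
Proof.
move=> ra rb p1; have D0 := is_derive_harm a b p v ra rb p1.
have D1 := is_derive_fst p v; have D2 := is_derive_snd p v.
have Dq := is_deriveD (is_deriveD (is_deriveD (is_derive_cst c0 p v)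
  (is_deriveZ c1 D1)) (is_deriveZ c2 D2))
  (is_deriveZ c3 (is_deriveD (is_deriveM D1 D1) (is_deriveM D2 D2))).
apply: is_derive_eq (is_deriveD D0 Dq) _.
by rewrite /hpoly /GRing.scale /=; congr (_ + _); ring.
Qed.

Lemma continuous_hpoly a b c p : radius1 a -> radius1 b -> enorm p < 1 ->
  {for p, continuous (hpoly a b c)}.
Proof.
case: c => [[[c0 c1] c2] c3] ra rb p1.
have C1 : continuous (fst : R * R -> R) by move=> q; exact: cvg_fst.
have C2 : continuous (snd : R * R -> R) by move=> q; exact: cvg_snd.
rewrite /hpoly; apply: cvgD; first exact: continuous_harm.
apply: cvgD; first apply: cvgD; first apply: cvgD.
- exact: cvg_cst.
- by apply: cvgM; [exact: cvg_cst|exact: C1].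
- by apply: cvgM; [exact: cvg_cst|exact: C2].
apply: cvgM; [exact: cvg_cst|].
by apply: cvgD; apply: cvgM; [exact: C1|exact: C1|exact: C2|exact: C2].
Qed.

(** The predicate Ck mentions the derivatives as functions on the whole plane,
    but only their values on D matter. *)
Lemma Ck_eq {k D f g} : open D -> (forall p, D p -> f p = g p) ->
  Ck k D f -> Ck k D g.
Proof.
move=> oD; elim: k f g => [|k IH] f g fg /=.
  move=> [cf _]; split=> //; apply: subspace_eq_continuous cf.
  by move=> p; rewrite inE => /fg.
have nfg p : D p -> \forall q \near p, f q = g q.
  by move=> Dp; apply: filterS fg _; exact: open_nbhs_nbhs.
move=> [cf [d1 d2 C1 C2]]; split.
  by apply: subspace_eq_continuous cf => p; rewrite inE => /fg.
split.
- by move=> p Dp; apply: near_eq_derivable (nfg p Dp) (d1 p Dp).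
- by move=> p Dp; apply: near_eq_derivable (nfg p Dp) (d2 p Dp).
- by apply: IH C1 => p Dp; apply: near_eq_derive (nfg p Dp).
- by apply: IH C2 => p Dp; apply: near_eq_derive (nfg p Dp).
Qed.

Lemma Ck_hpoly k a b c : radius1 a -> radius1 b ->
  Ck k (unit_disc R) (hpoly a b c).
Proof.
elim: k a b c => [|k IH] a b c ra rb; split => //.
- rewrite continuous_open_subspace; last exact: open_disc.
  by move=> p; rewrite inE => p1; exact: continuous_hpoly.
- rewrite continuous_open_subspace; last exact: open_disc.
  by move=> p; rewrite inE => p1; exact: continuous_hpoly.
case: c => [[[c0 c1] c2] c3].
have D v p : unit_disc R p -> _ := is_derive_hpoly a b c0 c1 c2 c3 p v ra rb.
have ra' := radius1_dshift a ra; have rb' := radius1_dshift b rb.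
split.
- by move=> p /(D e1)[].
- by move=> p /(D e2)[].
- apply: Ck_eq (open_disc 1) _ (IH _ _ _ _ _); first by move=> p /(D e1)[_ /esym E]; exact: E.
  + exact: radius1_comb.
  + exact: radius1_comb.
- apply: Ck_eq (open_disc 1) _ (IH _ _ _ _ _); first by move=> p /(D e2)[_ /esym E]; exact: E.
  + exact: radius1_comb.
  + exact: radius1_comb.
Qed.

End power_series.

(** * Classical solutions are viscosity solutions *)

Section viscosity.
Context {R : realType}.

(** If the second derivative were negative, then the first one, which vanishes
    at p, would be negative at the points p + t v for small t > 0, and the mean
    value theorem would put some value of w below w p. *)
Lemma min_second_derive {V : normedModType R} (w : V -> R) (p v : V) :
  (\forall q \near p, derivable w q v) -> (\forall q \near p, w p <= w q) ->
  derivable ('D_v w) p v -> 'D_v w p = 0 /\ 0 <= 'D_v ('D_v w) p.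
Proof.
move=> dw mw ddw.
have C : {for (0 : R), continuous (fun t : R => p + t *: v)}.
  apply: continuousD; first exact: cst_continuous.
  exact: scalel_continuous.
have : \forall t \near (0 : R), derivable w (p + t *: v) v /\ w p <= w (p + t *: v).
  have : nbhs (p + (0 : R) *: v) [set q | derivable w q v /\ w p <= w q].
    by rewrite scale0r addr0; apply: filterI.
  exact: C.
move=> /nbhs_ballP[r /= r0 rH].
have inI (t : R) : t \in `]-r, r[%R -> derivable w (p + t *: v) v /\ w p <= w (p + t *: v).
  by rewrite in_itv /= -ltr_norml => tr; apply: rH; rewrite /ball /= sub0r normrN.
have slice (t : R) : t \in `]-r, r[%R ->
    is_derive t 1 (fun s : R => w (p + s *: v)) ('D_v w (p + t *: v)).
  by move=> /inI[/derivableP d _]; exact: is_derive_slice.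
have z : 0 \in `]-r, r[%R by rewrite in_itv /= oppr_lt0 r0.
have p0 : p + (0 : R) *: v = p by rewrite scale0r addr0.
have d0 : 'D_v w p = 0.
  have [_ E1] := slice 0 z.
  have [|||_ E2] := @derive1_at_min R (fun s : R => w (p + s *: v)) (-r) r 0 _ _ z.
  - by apply: ltW; lra.
  - by move=> t /slice[].
  - by move=> t /inI[_]; rewrite p0.
  by move: E1; rewrite E2 p0.
split=> //; rewrite leNgt; apply/negP => neg.
have : (h^-1 *: (('D_v w \o shift p) (h *: v) - 'D_v w p) @[h --> (0 : R)^'])
  --> 'D_v ('D_v w) p by exact: ddw.
move=> /cvgr_lt/(_ _ neg)/nbhs_ballP[r' /= r'0 r'H].
have [t [t0 tr tr']] : exists t, [/\ 0 < t, t < r & t < r'].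
  have m0 : 0 < Num.min r r' by rewrite lt_min r0 r'0.
  exists (Num.min r r' / 2); have : Num.min r r' / 2 < Num.min r r' by lra.
  by rewrite lt_min => /andP[? ?]; split => //; lra.
have sI (s : R) : s \in `[0, t]%R -> s \in `]-r, r[%R.
  by rewrite !in_itv /= => /andP[? ?]; apply/andP; split; lra.
have diff_t (s : R) : s \in `]0, t[%R -> is_derive s 1
    (fun s : R => w (p + s *: v)) ('D_v w (p + s *: v)).
  by move=> sI'; apply/slice/sI; exact: subset_itv_oo_cc sI'.
have cont_t : {within `[0, t], continuous (fun s : R => w (p + s *: v))}.
  by apply: derivable_within_continuous => s /sI/slice[].
have [c cI E] := MVT t0 diff_t cont_t.
move: cI E; rewrite in_itv /= p0 subr0 => /andP[c0 ct] E.
have tI : t \in `[0, t]%R by rewrite in_itv /= lexx ltW.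
have [_ wt] := inI t (sI t tI).
have /r'H : ball (0 : R) r' c.
  by rewrite /ball /= sub0r normrN gtr0_norm //; exact: lt_trans tr'.
rewrite gt_eqF //= d0 subr0 /shift /= addrC => /(_ isT).
rewrite /GRing.scale /= pmulr_rlt0 ?invr_gt0 // => neg'.
have : 'D_v w (p + c *: v) * t < 0 by rewrite pmulr_llt0.
by rewrite -E subr_lt0 ltNge wt.
Qed.

Implicit Types (D : set (R * R)) (f g u psi : R * R -> R) (p : R * R).

(** A test function touching u from below has the same gradient, and second
    derivatives along the axes that are no larger. *)
Lemma touching_comparison D u psi p : open D -> Ck 2 D u -> Ck 2 D psi -> D p ->
  locally_min (u \- psi) p ->
  grad u p = grad psi p /\ laplacian psi p <= laplacian u p.
Proof.
move=> oD [_ [u1 u2 Cu1 Cu2]] [_ [s1 s2 Cs1 Cs2]] Dp mp.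
have nD : nbhs p D by exact: open_nbhs_nbhs.
have dir v : (forall q, D q -> derivable u q v) -> (forall q, D q -> derivable psi q v) ->
    derivable ('D_v u) p v -> derivable ('D_v psi) p v ->
    'D_v u p = 'D_v psi p /\ 'D_v ('D_v psi) p <= 'D_v ('D_v u) p.
  move=> du ds ddu dds.
  have E q : D q -> 'D_v u q - 'D_v psi q = 'D_v (u \- psi) q.
    by move=> Dq; exact: esym (deriveB (du q Dq) (ds q Dq)).
  have nE : \forall q \near p, ('D_v u - 'D_v psi) q = 'D_v (u \- psi) q.
    by apply: filterS nD => q /E.
  have [] := @min_second_derive _ (u \- psi) p v.
  - by apply: filterS nD => q Dq; apply: derivableB; [exact: du|exact: ds].
  - exact: mp.
  - exact: (@near_eq_derivable R _ _ ('D_v u - 'D_v psi) _ p v nE (derivableB ddu dds)).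
  rewrite -(E p Dp) -(@near_eq_derive R _ _ ('D_v u - 'D_v psi) _ p v nE).
  by rewrite (deriveB ddu dds) subr_ge0 => /subr0_eq.
have [E1 L1] := dir e1 u1 s1 (let: conj _ (And4 d _ _ _) := Cu1 in d p Dp)
  (let: conj _ (And4 d _ _ _) := Cs1 in d p Dp).
have [E2 L2] := dir e2 u2 s2 (let: conj _ (And4 _ d _ _) := Cu2 in d p Dp)
  (let: conj _ (And4 _ d _ _) := Cs2 in d p Dp).
split; first by rewrite /grad E1 E2.
exact: (@lerD R _ _ _ _ L1 L2).
Qed.

(** At a touching point both gradients, hence both factors sg, agree; as this
    factor is nonnegative, the comparison of the Laplacians decides. *)
Lemma classical_viscosity (sg : R -> R) D f g u : open D ->
  (forall t, 0 <= t -> 0 <= sg t) ->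
  classical_solution sg D f g u -> viscosity_solution sg D f g u.
Proof.
move=> oD sg0 [C2u cu eqn bd]; split=> //; split.
- by case: C2u.
- move=> psi p Cs Dp mp.
  have [E L] := touching_comparison D u psi p oD C2u Cs Dp mp.
  rewrite -(eqn p Dp) E; exact: (ler_wpM2l (sg0 _ (enorm_ge0 _)) L).
- move=> psi p Cs Dp mp.
  have mp' : locally_min (psi \- u) p.
    by apply: filterS mp => q /=; rewrite -lerN2 !opprB.
  have [E L] := touching_comparison D psi u p oD Cs C2u Dp mp'.
  rewrite -(eqn p Dp) E; exact: (ler_wpM2l (sg0 _ (enorm_ge0 _)) L).
Qed.

End viscosity.

(** * The polar series, and the boundary datum *)

Section solution.
Context {R : realType}.
Implicit Types (p v : R * R) (r t : R) (a b : nat -> R).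

Notation zero := (fun _ : nat => 0 : R).
(* the quadratic part is u_p = 1/4 - (x^2 + y^2) / 4 *)
Notation U := (hpoly (@coef R) zero (4^-1, 0, 0, - 4^-1)).

Lemma sum_from2 (F : nat -> R) N : (forall n, (n < 2)%N -> F n = 0) ->
  \sum_(2 <= n < N) F n = \sum_(0 <= n < N) F n.
Proof.
move=> F0; have [N2|N2] := ltnP N 2.
  rewrite big_geq; last exact: ltnW.
  by rewrite big_nat big1 // => n /andP[_ nN]; apply: F0; exact: ltn_trans N2.
have z : \sum_(0 <= n < 2) F n = 0.
  by rewrite big_nat big1 // => n /andP[_ /F0].
by rewrite (big_cat_nat (leq0n 2) N2) /= z add0r.
Qed.

Lemma u_h_partialE r t N :
  u_h_partial r t N = hsum coef zero N (r * cos t, r * sin t).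
Proof.
rewrite /u_h_partial sum_from2 => [|n /coef_lt2 c0].
  by apply: eq_bigr => n _; rewrite zpow_polar /= /coef; ring.
by move: c0; rewrite /coef => ->; rewrite mulr0 mul0r.
Qed.

(** The value of u at a polar pair depends only on the point it represents: the
    polar series is a series in powers of z. *)
Lemma u_polarE r t : u_polar r t = U (r * cos t, r * sin t).
Proof.
rewrite /u_polar /u_p_polar /u_h_polar /harm /hpoly /=.
congr (_ + _).
  by congr (limn _); apply/funext => N; exact: u_h_partialE.
by rewrite !exprMn -mulrDr cos2Dsin2; field.
Qed.

Lemma u_solE : u_sol R = U.
Proof. by apply/funext => p; rewrite /u_sol u_polarE -angleP. Qed.

Lemma radius1_coef : radius1 (@coef R).
Proof.
move=> r /andP[r0 r1]; exists (ln 2)^-1 => n; rewrite ger0_norm ?coef_ge0 //.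
apply: le_trans (coef_le n); rewrite ler_piMr ?coef_ge0 //.
by rewrite exprn_ile1 // ltW.
Qed.

Lemma radius1_0 : radius1 zero.
Proof. by move=> r _; exists 0 => n; rewrite normr0 mul0r. Qed.

(** Domination by the convergent series of the coefficients reaches the boundary
    of the disc. *)
Lemma ucauchy_hsum_coef :
  ucauchy [set p | enorm p <= 1] (hsum (@coef R) zero).
Proof.
apply: (@ucauchy_dominated _ _ _ (fun n p => coef n * (zpow n p).1 + 0 * (zpow n p).2)
   (@coef R)); last by move=> e /coef_tail.
move=> n p /= p1; rewrite mul0r addr0 normrM ger0_norm ?coef_ge0 //.
have [z1 _] := zpow_le n p.
by rewrite ler_piMr ?coef_ge0 // (le_trans z1) // exprn_ile1 // enorm_ge0.
Qed.

Lemma cvgn_u_h_partial r t : 0 <= r <= 1 -> cvgn (u_h_partial r t).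
Proof.
move=> /andP[r0 r1].
have -> : u_h_partial r t = (hsum (@coef R) zero ^~ (r * cos t, r * sin t)).
  by apply/funext => N; exact: u_h_partialE.
apply: ucauchy_cvg ucauchy_hsum_coef _.
by rewrite /= enorm_polar.
Qed.

Lemma g_h_partialE t N : g_h_partial t N = u_h_partial 1 t N.
Proof. by apply: eq_bigr => n _; rewrite expr1n mulrC div1r. Qed.

Lemma g_h_polarE t : g_h_polar t = harm (@coef R) zero (cos t, sin t).
Proof.
rewrite /g_h_polar /harm; congr (limn _); apply/funext => N.
by rewrite g_h_partialE u_h_partialE !mul1r.
Qed.

Lemma g_hE t : g_h R (cos t, sin t) = g_h_polar t.
Proof.
rewrite /g_h !g_h_polarE; congr harm.
have := angleP (cos t, sin t).
have -> : enorm (cos t, sin t) = 1.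
  by rewrite -[RHS](enorm_polar 1 t) ?ler01 // !mul1r.
by rewrite !mul1r.
Qed.

(** The differentiated series is the sine series with coefficients 1 / (n ln n);
    it converges uniformly, so it is continuous and is the derivative. *)
Lemma C1_circle_g_h : C1_circle (g_h R).
Proof.
pose f N t : R := \sum_(0 <= n < N) coef n * cos (n%:R * t).
pose g N t : R := - \sum_(0 <= n < N) dcoef n * sin (n%:R * t).
have ug : ucauchy setT g.
  move=> e /ucauchy_sine[N HN]; exists N => n t Nn _.
  by rewrite /g -opprB normrN opprK addrC HN.
have Dl (n : nat) t : is_derive t 1 (fun s : R => n%:R * s) n%:R.
  apply: is_derive_eq (is_deriveZ (n%:R) (is_derive_id t 1)) _.
  by rewrite /GRing.scale /= mulr1.
have D N t : is_derive t 1 (f N) (g N t).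
  elim: N => [|N IH].
    have -> : f 0%N = cst 0 by apply/funext => s; rewrite /f big_geq.
    by rewrite /g big_geq // oppr0; exact: is_derive_cst.
  have -> : f N.+1 = (fun s => f N s + coef N * cos (N%:R * s)).
    by apply/funext => s; rewrite /f big_nat_recr.
  have Dc := is_deriveZ (coef N) (is_derive1_comp (is_derive_cos (N%:R * t)) (Dl N t)).
  apply: is_derive_eq (is_deriveD IH Dc) _.
  by rewrite /g big_nat_recr //= -muln_coef /GRing.scale /=; ring.
have D2 N t : is_derive t 1 (g N) (- \sum_(0 <= n < N) dcoef n * (n%:R * cos (n%:R * t))).
  elim: N => [|N IH].
    have -> : g 0%N = cst 0 by apply/funext => s; rewrite /g big_geq // oppr0.
    by rewrite big_geq // oppr0; exact: is_derive_cst.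
  have -> : g N.+1 = (fun s => g N s - dcoef N * sin (N%:R * s)).
    by apply/funext => s; rewrite /g big_nat_recr //= opprD.
  have Dc := is_deriveZ (dcoef N) (is_derive1_comp (is_derive_sin (N%:R * t)) (Dl N t)).
  apply: is_derive_eq (is_deriveB IH Dc) _.
  by rewrite big_nat_recr //= /GRing.scale /=; ring.
have cf t : cvgn (f ^~ t).
  have -> : f ^~ t = g_h_partial t.
    apply/funext => N; rewrite /f -sum_from2 => [|n /coef_lt2->]; last by rewrite mul0r.
    by apply: eq_bigr => n _; rewrite mulrC.
  have -> : g_h_partial t = u_h_partial 1 t.
    by apply/funext => N; exact: g_h_partialE.
  by apply: cvgn_u_h_partial; rewrite ler01 lexx.
have E : (fun t => g_h R (cos t, sin t)) = (fun t => limn (f ^~ t)).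
  apply/funext => t; rewrite g_hE /g_h_polar; congr (limn _); apply/funext => N.
  rewrite /f -sum_from2 => [|n /coef_lt2->]; last by rewrite mul0r.
  by apply: eq_bigr => n _; rewrite mulrC.
have DL t : is_derive t 1 (fun t => limn (f ^~ t)) (limn (g ^~ t)).
  by apply: (is_derive_ulim (A := setT)) => //; exact: openT.
rewrite /C1_circle E; split=> [t|]; first by case: (DL t).
have -> : derive1 (fun t => limn (f ^~ t)) = (fun t => limn (g ^~ t)).
  by apply/funext => t; rewrite derive1E; case: (DL t).
apply/continuous_subspace_setT; apply: ulim_continuous ug => N.
apply: continuous_subspaceT => t.
by apply/differentiable_continuous/derivable1_diffP; case: (D2 N t).
Qed.

(** * The differential equation *)

Lemma closure_disc : closure (unit_disc R) `<=` [set p | enorm p <= 1].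
Proof.
rewrite [X in _ `<=` X](closure_id _).1; last exact: closed_disc.
by apply: closureS => p /= /ltW.
Qed.

Lemma continuous_closure_u_sol : {within closure (unit_disc R), continuous (u_sol R)}.
Proof.
apply: continuous_subspaceW closure_disc _; rewrite u_solE.
have C1 : continuous (fst : R * R -> R) by move=> q; exact: cvg_fst.
have C2 : continuous (snd : R * R -> R) by move=> q; exact: cvg_snd.
apply: (@within_continuousD _ _ _ _ (harm (@coef R) zero)
   (fun p => 4^-1 + 0 * p.1 + 0 * p.2 + - 4^-1 * (p.1 ^+ 2 + p.2 ^+ 2))).
  apply: ulim_continuous ucauchy_hsum_coef => N.
  exact/continuous_subspaceT/continuous_hsum.
apply: continuous_subspaceT => p.
apply: cvgD; first apply: cvgD; first apply: cvgD.
- exact: cvg_cst.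
- by apply: cvgM; [exact: cvg_cst|exact: C1].
- by apply: cvgM; [exact: cvg_cst|exact: C2].
apply: cvgM; [exact: cvg_cst|].
by apply: cvgD; apply: cvgM; [exact: C1|exact: C1|exact: C2|exact: C2].
Qed.

Lemma bdry_disc p : bdry (unit_disc R) p -> enorm p = 1.
Proof.
move=> [/closure_disc /= p1 np]; apply/le_anti; rewrite p1 /= leNgt.
apply/negP => p1'; apply: np.
by rewrite (interior_id _).1 //; exact: open_disc.
Qed.

Lemma u_sol_bdry p : bdry (unit_disc R) p -> u_sol R p = g_h R p.
Proof.
move=> /bdry_disc p1; rewrite /u_sol p1 /g_h g_h_polarE u_polarE !mul1r /hpoly /=.
by rewrite cos2Dsin2; ring.
Qed.

Lemma harmN a b p : cvgn (hsum a b ^~ p) ->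
  harm (fun n => - a n) (fun n => - b n) p = - harm a b p.
Proof.
move=> cab; rewrite /harm -limN //; congr (limn _); apply/funext => N.
transitivity (- hsum a b N p) => //.
by rewrite /hsum -sumrN; apply: eq_bigr => n _; ring.
Qed.

(** With v = 1 and v = i the second derivatives of the power series are
    multiplied by 1 and i ^ 2 = -1, so they cancel. *)
Lemma laplacian_hpoly a b c0 c1 c2 c3 p : radius1 a -> radius1 b ->
  unit_disc R p -> laplacian (hpoly a b (c0, c1, c2, c3)) p = 4 * c3.
Proof.
move=> ra rb Dp.
have nD : nbhs p (unit_disc R) by apply: open_nbhs_nbhs; split => //; exact: open_disc.
have ra' := radius1_dshift a ra; have rb' := radius1_dshift b rb.
pose A v n := v.1 * dshift a n + v.2 * dshift b n.
pose B v n := v.1 * dshift b n + (- v.2) * dshift a n.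
have rA v : radius1 (A v) by exact: radius1_comb.
have rB v : radius1 (B v) by exact: radius1_comb.
have second v : 'D_v ('D_v (hpoly a b (c0, c1, c2, c3))) p =
    hpoly (fun n => v.1 * dshift (A v) n + v.2 * dshift (B v) n)
      (fun n => v.1 * dshift (B v) n + (- v.2) * dshift (A v) n)
      (v.1 * (2 * v.1 * c3) + v.2 * (2 * v.2 * c3), 2 * v.1 * 0, 2 * v.2 * 0, 0) p.
  rewrite -(is_derive_hpoly (A v) (B v) (v.1 * c1 + v.2 * c2) (2 * v.1 * c3)
     (2 * v.2 * c3) 0 p v (rA v) (rB v) Dp).(derive_val).
  apply: near_eq_derive; apply: filterS nD => q Dq.
  exact: (is_derive_hpoly a b c0 c1 c2 c3 q v ra rb Dq).(derive_val).
have -> : laplacian (hpoly a b (c0, c1, c2, c3)) p =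
   'D_e1 ('D_e1 (hpoly a b (c0, c1, c2, c3))) p +
   'D_e2 ('D_e2 (hpoly a b (c0, c1, c2, c3))) p by [].
rewrite !second /hpoly.
pose a2 := dshift (dshift a); pose b2 := dshift (dshift b).
have -> : (fun n => e1.1 * dshift (A e1) n + e1.2 * dshift (B e1) n) = a2.
  by apply/funext => n; rewrite /A /B /a2 /dshift /e1 /=; ring.
have -> : (fun n => e1.1 * dshift (B e1) n + - e1.2 * dshift (A e1) n) = b2.
  by apply/funext => n; rewrite /A /B /b2 /dshift /e1 /=; ring.
have -> : (fun n => e2.1 * dshift (A e2) n + e2.2 * dshift (B e2) n) = (fun n => - a2 n).
  by apply/funext => n; rewrite /A /B /a2 /dshift /e2 /=; ring.
have -> : (fun n => e2.1 * dshift (B e2) n + - e2.2 * dshift (A e2) n) = (fun n => - b2 n).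
  by apply/funext => n; rewrite /A /B /b2 /dshift /e2 /=; ring.
rewrite harmN; last by apply: cvgn_hsum => //; exact: radius1_dshift.
by rewrite /e1 /e2 /=; ring.
Qed.

Lemma classical_u_sol :
  classical_solution (sigma R) (unit_disc R) (f_rhs R) (g_h R) (u_sol R).
Proof.
split.
- by rewrite u_solE; apply: Ck_hpoly; [exact: radius1_coef|exact: radius1_0].
- exact: continuous_closure_u_sol.
- move=> p Dp; have -> : laplacian (u_sol R) p = -1.
    rewrite u_solE laplacian_hpoly //; [by field|exact: radius1_coef|exact: radius1_0].
  by rewrite mulrN1.
- exact: u_sol_bdry.
Qed.

Lemma sigma_ge0 (t : R) : 0 <= t -> 0 <= sigma R t.
Proof. by move=> t0; rewrite divr_ge0 ?mulr_ge0 ?addr_ge0. Qed.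

(** The function t |-> - sigma |t|; the absolute value makes it continuous on the
    whole line, so that continuity and measurability of the right-hand side
    follow by composition. *)
Definition msigma (t : R) : R := - (2 * `|t| / (1 + `|t|)).

Lemma continuous_msigma : continuous msigma.
Proof.
move=> t; apply: cvgN; apply: cvgM.
  by apply: cvgM; [exact: cvg_cst|exact: norm_continuous].
apply: cvgV; first by rewrite gt_eqF // ltr_pwDl.
by apply: cvgD; [exact: cvg_cst|exact: norm_continuous].
Qed.

Lemma norm_msigma_le (t : R) : `|msigma t| <= 2.
Proof.
have d : 0 < 1 + `|t| by rewrite ltr_pwDl.
rewrite /msigma normrN ger0_norm; last by rewrite divr_ge0 ?mulr_ge0 // ltW.
by rewrite ler_pdivrMr // ler_pM2l // lerDr.
Qed.

Lemma f_rhsE : f_rhs R = msigma \o (@enorm R) \o grad (u_sol R).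
Proof. by apply/funext => p; rewrite /= /msigma ger0_norm ?enorm_ge0. Qed.

Lemma continuous_f_rhs : {within unit_disc R, continuous (f_rhs R)}.
Proof.
have [_ [_ _ [C1 _] [C2 _]]] : Ck 1 (unit_disc R) (u_sol R).
  by rewrite u_solE; apply: Ck_hpoly; [exact: radius1_coef|exact: radius1_0].
have C v : {within unit_disc R, continuous ('D_v (u_sol R))} ->
    {in unit_disc R, continuous ('D_v (u_sol R))}.
  by rewrite continuous_open_subspace //; exact: open_disc.
rewrite continuous_open_subspace; last exact: open_disc.
move=> p Dp; rewrite f_rhsE.
have Cg : grad (u_sol R) q @[q --> p] --> grad (u_sol R) p.
  exact: cvg_pair (C e1 C1 p Dp) (C e2 C2 p Dp).
apply: continuous_comp Cg _; apply: continuous_comp; first exact: continuous_enorm.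
exact: continuous_msigma.
Qed.

(** * The right-hand side is bounded and measurable *)

Notation plane := (measurableTypeR R * measurableTypeR R)%type.

Lemma measurable_zpow n :
  measurable_fun setT (fun p : plane => (zpow n p).1 : R) /\
  measurable_fun setT (fun p : plane => (zpow n p).2 : R).
Proof.
have m1 : measurable_fun setT (fun p : plane => p.1 : R) by exact: measurable_fst.
have m2 : measurable_fun setT (fun p : plane => p.2 : R) by exact: measurable_snd.
elim: n => [|n [IH1 IH2]] /=; first by split; exact: measurable_cst.
split; first by apply: measurable_funB; apply: measurable_funM.
by apply: measurable_funD; apply: measurable_funM.
Qed.

Lemma measurable_hsum a b N : measurable_fun setT (hsum a b N : plane -> R).
Proof.
apply: measurable_sum => n; have [m1 m2] := measurable_zpow n.
by apply: measurable_funD; apply: measurable_funM.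
Qed.

Lemma measurable_enorm : measurable_fun setT (@enorm R : plane -> R).
Proof.
have m1 : measurable_fun setT (fun p : plane => p.1 : R) by exact: measurable_fst.
have m2 : measurable_fun setT (fun p : plane => p.2 : R) by exact: measurable_snd.
apply: (measurableT_comp (f := (@Num.sqrt R)) (g := fun p : plane => p.1 ^+ 2 + p.2 ^+ 2 : R)).
  by apply: continuous_measurable_fun; exact: sqrt_continuous.
by apply: measurable_funD; apply: measurable_funX.
Qed.

Lemma measurable_disc : measurable (unit_disc R : set plane).
Proof.
have -> : (unit_disc R : set plane) = setT `&` (@enorm R : plane -> R) @^-1` `]-oo, 1[%classic.
  by rewrite setTI; apply/seteqP; split=> p; rewrite /unit_disc /= in_itv.
exact: measurable_enorm.
Qed.

(** A pointwise limit of polynomials in the coordinates is measurable for the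
    product sigma-algebra. *)
Lemma measurable_hpoly a b c : radius1 a -> radius1 b ->
  measurable_fun (unit_disc R : set plane) (hpoly a b c : plane -> R).
Proof.
case: c => [[[c0 c1] c2] c3] ra rb.
have m1 : measurable_fun setT (fun p : plane => p.1 : R) by exact: measurable_fst.
have m2 : measurable_fun setT (fun p : plane => p.2 : R) by exact: measurable_snd.
apply: measurable_funD.
  apply: (measurable_fun_cvg (h := hsum a b)) => [N|p Dp].
    by apply: measurable_funTS; exact: measurable_hsum.
  exact: cvgn_hsum.
apply: measurable_funTS; apply: measurable_funD.
  by apply: measurable_funD; [apply: measurable_funD => //|]; apply: measurable_funM.
by apply: measurable_funM => //; apply: measurable_funD; apply: measurable_funX.
Qed.

Lemma measurable_f_rhs : measurable_fun (unit_disc R : set plane) (f_rhs R : plane -> R).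
Proof.
have mD v : measurable_fun (unit_disc R : set plane) ('D_v (u_sol R) : plane -> R).
  apply: eq_measurable_fun (measurable_hpoly _ _ _
    (radius1_comb v.1 v.2 _ _ (radius1_dshift _ radius1_coef) (radius1_dshift _ radius1_0))
    (radius1_comb v.1 (- v.2) _ _ (radius1_dshift _ radius1_0) (radius1_dshift _ radius1_coef))).
  move=> p; rewrite inE => Dp; apply/esym; rewrite u_solE.
  exact: (is_derive_hpoly _ _ _ _ _ _ p v radius1_coef radius1_0 Dp).(derive_val).
rewrite f_rhsE.
apply: (measurableT_comp (f := msigma)
  (g := fun p : plane => Num.sqrt ('D_e1 (u_sol R) p ^+ 2 + 'D_e2 (u_sol R) p ^+ 2))).
  by apply: continuous_measurable_fun; exact: continuous_msigma.
apply: (measurableT_comp (f := @Num.sqrt R)).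
  by apply: continuous_measurable_fun; exact: sqrt_continuous.
by apply: measurable_funD; apply: measurable_funX; exact: mD.
Qed.

Lemma Linfty_f_rhs : Linfty (unit_disc R) (f_rhs R).
Proof.
apply/andP; split; rewrite inE /=.
  exact: (measurable_restrictT _ measurable_disc).1 measurable_f_rhs.
rewrite /finite_norm unlock /=; case: ifP => _; last exact: ltry.
apply: (@le_lt_trans _ _ (2%:E)); last exact: ltry.
apply/ess_supP; apply: aeW => p /=; rewrite lee_fin patchE.
case: ifP => _; last by rewrite normr0.
rewrite f_rhsE /=; exact: norm_msigma_le.
Qed.

(** * Blow-up of the radial derivative *)

Lemma u_polar0E : u_polar ^~ 0 = (fun r => u_sol R (0 + r *: e1)).
Proof.
apply/funext => r; rewrite u_polarE -u_solE cos0 sin0 mulr1 mulr0 add0r; congr u_sol.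
by rewrite /e1; congr pair; rewrite /GRing.scale /= ?mulr1 ?mulr0.
Qed.

Lemma ray_disc r : 0 < r < 1 -> unit_disc R (0 + r *: e1).
Proof.
move=> /andP[r0 r1]; rewrite add0r /unit_disc /=.
have -> : r *: e1 = (r * cos 0, r * sin 0).
  by rewrite cos0 sin0 /e1; congr pair; rewrite /GRing.scale /=.
by rewrite enorm_polar // ltW.
Qed.

Lemma is_derive_u_polar0 r : 0 < r < 1 ->
  is_derive r 1 (u_polar ^~ 0) ('D_e1 (u_sol R) (0 + r *: e1)).
Proof.
move=> /ray_disc Dr; rewrite u_polar0E; apply: is_derive_slice.
apply/derivableP; rewrite u_solE.
exact: (is_derive_hpoly _ _ _ _ _ _ _ e1 radius1_coef radius1_0 Dr).(ex_derive).
Qed.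

(** On the positive axis every term of the differentiated series is nonnegative,
    so the series dominates its partial sums; - r / 2 comes from u_p. *)
Lemma sum_dcoef_le_derive r N : 0 < r < 1 ->
  \sum_(0 <= n < N) dcoef n.+1 * r ^+ n - r / 2 <= 'D_e1 (u_sol R) (0 + r *: e1).
Proof.
move=> r01; have Dr := ray_disc r r01; have /andP[r0 r1] := r01.
rewrite u_solE (is_derive_hpoly _ _ _ _ _ _ _ e1 radius1_coef radius1_0 Dr).(derive_val).
rewrite /hpoly; apply: lerD; last first.
  by rewrite /e1 /= /GRing.scale /=; lra.
set A := fun n => _ + e1.2 * _; set B := fun n => _ * dshift zero n + _.
have hE n : hsum A B n (0 + r *: e1) = \sum_(0 <= k < n) dcoef k.+1 * r ^+ k.
  apply: eq_bigr => k _; have -> : 0 + r *: e1 = (r * cos 0, r * sin 0).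
    by rewrite add0r cos0 sin0 /e1; congr pair; rewrite /GRing.scale /=.
  rewrite zpow_polar mulr0 cos0 sin0 /= /A /e1 /= /dshift -muln_coef; ring.
rewrite -hE; apply: nondecreasing_cvgn_le.
  move=> m n mn; rewrite !hE (big_cat_nat (leq0n m) mn) /= lerDl.
  by rewrite sumr_ge0 // => k _; rewrite mulr_ge0 ?dcoef_ge0 // exprn_ge0 // ltW.
apply: cvgn_hsum => //; apply: radius1_comb; apply: radius1_dshift;
  by [exact: radius1_coef|exact: radius1_0].
Qed.

Lemma near_left1 : \forall r \near (1 : R)^'-, 0 < r < 1.
Proof.
near=> r; apply/andP; split; near: r; [exact: nbhs_left_gt|exact: nbhs_left_lt].
Unshelve. all: by end_near. Qed.

(** The partial sums are continuous at r = 1, where they are partial sums of the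
    divergent series with terms 1 / (n ln n). *)
Lemma derive_ray_cvgy : 'D_e1 (u_sol R) (0 + r *: e1) @[r --> (1 : R)^'-] --> +oo.
Proof.
apply/cvgryPge => M.
have [N HN] := @sum_dcoef_unbounded R (M + 2).
pose P N r := \sum_(0 <= n < N) dcoef n.+1 * r ^+ n.
have P1 : M + 2 <= P N 1.
  apply: le_trans HN _; rewrite /P; case: N => [|n]; first by rewrite !big_geq.
  rewrite big_nat_recl // dcoef_lt2 // add0r big_nat_recr //=.
  under [X in _ <= X + _]eq_bigr do rewrite expr1n mulr1.
  by rewrite lerDl mulr_ge0 ?dcoef_ge0 // exprn_ge0.
have CP n : continuous (P n).
  move=> r; elim: n => [|n IH].
    have -> : P 0%N = cst 0 by apply/funext => s; rewrite /P big_geq.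
    exact: cvg_cst.
  have -> : P n.+1 = (fun s => P n s + dcoef n.+1 * s ^+ n).
    by apply/funext => s; rewrite /P big_nat_recr.
  apply: cvgD IH _; apply: cvgM; first exact: cvg_cst; exact: exprn_continuous.
have : \forall r \near (1 : R)^'-, M + 1 < P N r.
  apply: (cvgr_gt (P N 1)); last by lra.
  exact: cvg_at_left_filter (CP N 1).
move=> nP; near=> r.
have r01 : 0 < r < 1 by near: r; exact: near_left1.
have : M + 1 < P N r by near: r.
have := sum_dcoef_le_derive r N r01; rewrite -/(P N r).
by move: r01 => /andP[? ?]; lra.
Unshelve. all: by end_near. Qed.

Lemma derive1_u_polar0_cvgy :
  derive1 (u_polar ^~ 0) r @[r --> (1 : R)^'-] --> +oo.
Proof.
apply: cvg_trans derive_ray_cvgy; apply: near_eq_cvg; near=> r.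
rewrite derive1E; apply/esym.
by apply: (is_derive_u_polar0 r _).(derive_val); near: r; exact: near_left1.
Unshelve. all: by end_near. Qed.

(** A continuous extension of the x-derivative to the closed disc would stay
    bounded along the ray that ends at (1, 0). *)
Lemma not_C1_closure_u_sol : ~ C1_closure (unit_disc R) (u_sol R).
Proof.
move=> [_ _ [g cg gE] _].
have C : (fun r : R => 0 + r *: e1) @ 1^'- --> (0 + 1 *: e1 : R * R).
  apply: cvg_at_left_filter; apply: cvgD; first exact: cvg_cst.
  exact: scalel_continuous.
have cl : closure (unit_disc R) (0 + 1 *: e1).
  move=> B /C nB.
  have /filter_ex[r [Br Dr]] : \forall r \near (1 : R)^'-, B (0 + r *: e1) /\ 0 < r < 1.
    by apply: filterI; [exact: nB|exact: near_left1].
  by exists (0 + r *: e1); split=> //; exact: ray_disc.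
move/subspace_continuousP/(_ _ cl)/cvgrPdist_le/(_ _ ltr01) : cg => cg.
have /filter_ex[r [[/= g1 D1] r01]] : \forall r \near (1 : R)^'-,
   (`|g (0 + 1 *: e1) - g (0 + r *: e1)| <= 1 /\
    g (0 + 1 *: e1) + 2 <= 'D_e1 (u_sol R) (0 + r *: e1)) /\ 0 < r < 1.
  apply: filterI; last exact: near_left1.
  apply: filterI.
    have := C _ cg; apply: filterS2 near_left1 => r r01; apply.
    exact/subset_closure/ray_disc.
  by have /cvgryPge := derive_ray_cvgy; apply.
move: g1 D1; rewrite -gE; last exact: ray_disc.
by rewrite ler_distl; lra.
Qed.

End solution.

(** * The theorem *)

Theorem mainTheorem3 (R : realType) :
  (* the series converge, and u and g_h are well defined by their polar forms *)
  (forall r theta : R, 0 <= r <= 1 ->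
     cvgn (u_h_partial r theta) /\
     u_sol R (r * cos theta, r * sin theta) = u_polar r theta) /\
  (forall theta : R,
     cvgn (g_h_partial theta) /\
     g_h R (cos theta, sin theta) = g_h_polar theta) /\
  C1_circle (g_h R) /\
  {within closure (unit_disc R), continuous (u_sol R)} /\
  Cinfty (unit_disc R) (u_sol R) /\
  classical_solution (sigma R) (unit_disc R) (f_rhs R) (g_h R) (u_sol R) /\
  viscosity_solution (sigma R) (unit_disc R) (f_rhs R) (g_h R) (u_sol R) /\
  {within unit_disc R, continuous (f_rhs R)} /\
  Linfty (unit_disc R) (f_rhs R) /\
  (forall r : R, 0 < r < 1 -> derivable (u_polar ^~ 0) r 1) /\
  derive1 (u_polar ^~ 0) r @[r --> (1 : R)^'-] --> +oo /\
  ~ C1_closure (unit_disc R) (u_sol R).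
Proof.
have C2 k : Ck k (unit_disc R) (u_sol R).
  by rewrite u_solE; apply: Ck_hpoly; [exact: radius1_coef|exact: radius1_0].
split.
  move=> r theta r01; split; first exact: cvgn_u_h_partial.
  by rewrite u_solE u_polarE.
split.
  move=> theta; split; last exact: g_hE.
  have -> : g_h_partial theta = u_h_partial 1 theta.
    by apply/funext => N; exact: g_h_partialE.
  by apply: cvgn_u_h_partial; rewrite ler01 lexx.
split; first exact: C1_circle_g_h.
split; first exact: continuous_closure_u_sol.
split; first exact: C2.
split; first exact: classical_u_sol.
split.
  apply: classical_viscosity; [exact: open_disc|exact: sigma_ge0|].
  exact: classical_u_sol.
split; first exact: continuous_f_rhs.
split; first exact: Linfty_f_rhs.
split; first by move=> r /is_derive_u_polar0 D; exact: ex_derive.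
split; first exact: derive1_u_polar0_cvgy.
exact: not_C1_closure_u_sol.
Qed.
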